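(* Let $c,d\in\mathbb{R}$, not both zero, and let $\alpha^*=\alpha+\lambda T$ be a $T$-$P^*$ associated curve of $\alpha$ (with respect to $c,d$). Then the curvature $\kappa^*$ and the torsion $\tau^*$ of $\alpha^*$ are $$\kappa^*=\frac{\tau\sqrt{c^2+d^2}}{d\,\lambda\kappa}=\frac{\sqrt{\kappa^2+\tau^2}}{\lambda\kappa},\qquad \tau^*=\frac{\kappa\tau'-\kappa'\tau}{\lambda\kappa(\kappa^2+\tau^2)}$$ (the first expression for $\kappa^*$ being meant for $d\neq0$).
   Context: $\alpha$ is a smooth curve in $E^3$ parametrized by arc length $s$, with Frenet frame $\{T,N,B\}$, curvature $\kappa>0$ and torsion $\tau$: $T'=\kappa N$, $N'=-\kappa T+\tau B$, $B'=-\tau N$. For a curve $\alpha^*$ with the same parameter $s$ (regular, not necessarily unit speed, with ${\alpha^*}'\wedge{\alpha^*}''\ne 0$), $T^*={\alpha^*}'/\|{\alpha^*}'\|$, $B^*=({\alpha^*}'\wedge{\alpha^*}'')/\|{\alpha^*}'\wedge{\alpha^*}''\|$, $N^*=B^*\wedge T^*$, $\kappa^*=\|{\alpha^*}'\wedge{\alpha^*}''\|/\|{\alpha^*}'\|^3$, $\tau^*=\langle{\alpha^*}'\wedge{\alpha^*}'',{\alpha^*}'''\rangle/\|{\alpha^*}'\wedge{\alpha^*}''\|^2$. For real constants $c,d$ put $P^*=\frac{cN^*+dB^*}{\sqrt{c^2+d^2}}$. The curve $\alpha^*$ is called a $T$-$P^*$ associated curve of $\alpha$ if $\alpha^*=\alpha+\lambda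 T$ for a smooth real function $\lambda$ of $s$ and $T$ is linearly dependent with $P^*$, normalized so that $T=P^*$.
   Formalization: The printed formulas for κ* are proved where λ>0; where λ<0 they are false, since κ*>0 (e.g. a circular helix with λ=−s, s>0), and are replaced there by their negatives; λ≠0 is proved, and the formula for τ* holds for both signs. *)

(* Defs.v *)
From HB Require Import structures.
From mathcomp Require Export all_boot all_order all_algebra.
From mathcomp Require Export all_classical all_reals all_analysis.
Export numFieldNormedType.Exports.

Set Implicit Arguments.
Unset Strict Implicit.
Unset Printing Implicit Defensive.

Import Order.TTheory GRing.Theory Num.Theory.
Local Open Scope ring_scope.
Local Open Scope classical_set_scope.

Section Euclidean3.
Variable R : realType.
Implicit Types u v : 'rV[R]_3.

Definition dotv u v : R := \sum_(i < 3) u 0 i * v 0 i.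

(* Not the library norm `|u|, which on row vectors is the sup norm. *)
Definition enorm u : R := Num.sqrt (dotv u u).

(* Indices are taken in Z/3. *)
Definition crossv u v : 'rV[R]_3 :=
  \row_(i < 3) (u 0 (i + 1) * v 0 (i + 2) - u 0 (i + 2) * v 0 (i + 1)).

End Euclidean3.

Section Curves.
Variable R : realType.
Implicit Types (I : set R) (g a : R -> 'rV[R]_3) (kappa tau lambda : R -> R).

(* For an open set I; the values of f outside I are irrelevant. *)
Definition smooth_on I (V : normedModType R) (f : R -> V) : Prop :=
  forall (n : nat) (s : R), I s -> derivable (derive1n n f) s 1.

Definition regular_on I g : Prop :=
  forall s, I s ->
    derive1 g s != 0 /\ crossv (derive1 g s) (derive1n 2 g s) != 0.

Definition tangent g (s : R) : 'rV[R]_3 :=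
  (enorm (derive1 g s))^-1 *: derive1 g s.

Definition binormal g (s : R) : 'rV[R]_3 :=
  (enorm (crossv (derive1 g s) (derive1n 2 g s)))^-1
    *: crossv (derive1 g s) (derive1n 2 g s).

Definition normal g (s : R) : 'rV[R]_3 := crossv (binormal g s) (tangent g s).

Definition curvature g (s : R) : R :=
  enorm (crossv (derive1 g s) (derive1n 2 g s)) / enorm (derive1 g s) ^+ 3.

Definition torsion g (s : R) : R :=
  dotv (crossv (derive1 g s) (derive1n 2 g s)) (derive1n 3 g s)
    / enorm (crossv (derive1 g s) (derive1n 2 g s)) ^+ 2.

(* The frame is positively oriented and orthonormal: T, N are orthonormal and
   B is their vector product.  Since T is a unit vector, the curve a is
   parametrized by arc length. *)
Record frenet_frame I a (T N B : R -> 'rV[R]_3) kappa tau : Prop := FrenetFrame {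
  frenet_curve : forall s, I s -> is_derive s (1 : R) a (T s);
  frenet_TT : forall s, I s -> dotv (T s) (T s) = 1;
  frenet_NN : forall s, I s -> dotv (N s) (N s) = 1;
  frenet_TN : forall s, I s -> dotv (T s) (N s) = 0;
  frenet_B : forall s, I s -> B s = crossv (T s) (N s);
  frenet_kappa_gt0 : forall s, I s -> 0 < kappa s;
  frenet_dT : forall s, I s -> is_derive s (1 : R) T (kappa s *: N s);
  frenet_dN : forall s, I s ->
    is_derive s (1 : R) N (- kappa s *: T s + tau s *: B s);
  frenet_dB : forall s, I s -> is_derive s (1 : R) B (- tau s *: N s)
}.

Definition Pvec (c d : R) g (s : R) : 'rV[R]_3 :=
  (Num.sqrt (c ^+ 2 + d ^+ 2))^-1 *: (c *: normal g s + d *: binormal g s).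

Record TP_associated I (c d : R) a (T : R -> 'rV[R]_3) lambda astar : Prop :=
  TPAssociated {
  TP_lambda_smooth : smooth_on I lambda;
  TP_curve : forall s, I s -> astar s = a s + lambda s *: T s;
  TP_regular : regular_on I astar;
  TP_direction : forall s, I s -> T s = Pvec c d astar s
}.

End Curves.

(* Main.v *)
(* Since T = P^* is orthogonal to T^*, the velocity (1 + lambda') T +
   lambda kappa N of the associated curve has no T component, so it equals
   mu N with mu = lambda kappa, which is nonzero by regularity.  For any curve
   with velocity mu N, the vector product of the first two derivatives is mu^2
   times the Darboux vector kappa B + tau T, which gives the second curvature
   formula and the torsion formula.  Then B^* is the normalized Darboux vector,
   and comparing <T, B^*> = tau / sqrt (kappa^2 + tau^2) with <P^*, B^*> =
   d / sqrt (c^2 + d^2) gives the first curvature formula.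
   The derivatives of kappa and tau exist because kappa = <alpha'', N> and
   kappa tau = <alpha''', B>. *)
Require Import Defs.
From mathcomp Require Import ring.

Set Implicit Arguments.
Unset Strict Implicit.
Unset Printing Implicit Defensive.

Import Order.TTheory GRing.Theory Num.Theory.
Local Open Scope ring_scope.
Local Open Scope classical_set_scope.

(** * Inner and vector products in coordinates *)

Section VectorAlgebra.
Variable R : realType.
Implicit Types (u v w : 'rV[R]_3) (k : R).

(** Here and in the next two lemmas the last index is spelled [1 + 1], so that coordinate expansions
    share the same atoms when [ring] is called. *)
Lemma dotv3E u v :
  dotv u v = u 0 0 * v 0 0 + u 0 1 * v 0 1 + u 0 (1 + 1) * v 0 (1 + 1).
Proof.
rewrite /dotv !big_ord_recl big_ord0 addr0 addrA.
by congr (_ + _ + _); congr (u 0 _ * v 0 _); apply: val_inj.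
Qed.

Lemma crossv3E u v :
  [/\ crossv u v 0 0 = u 0 1 * v 0 (1 + 1) - u 0 (1 + 1) * v 0 1,
      crossv u v 0 1 = u 0 (1 + 1) * v 0 0 - u 0 0 * v 0 (1 + 1)
    & crossv u v 0 (1 + 1) = u 0 0 * v 0 1 - u 0 1 * v 0 0].
Proof.
by split; rewrite mxE; congr (u 0 _ * v 0 _ - u 0 _ * v 0 _); apply: val_inj.
Qed.

Lemma rV3P u v :
  u 0 0 = v 0 0 -> u 0 1 = v 0 1 -> u 0 (1 + 1) = v 0 (1 + 1) -> u = v.
Proof.
move=> e0 e1 e2; apply/rowP => -[[|[|[|//]]] i3].
- by rewrite (_ : Ordinal i3 = 0) //; apply: val_inj.
- by rewrite (_ : Ordinal i3 = 1) //; apply: val_inj.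
- by rewrite (_ : Ordinal i3 = 1 + 1) //; apply: val_inj.
Qed.

Lemma dotvC u v : dotv u v = dotv v u.
Proof. by rewrite !dotv3E; ring. Qed.

Lemma dotvDl u v w : dotv (u + v) w = dotv u w + dotv v w.
Proof. by rewrite !dotv3E !mxE; ring. Qed.

Lemma dotvDr u v w : dotv w (u + v) = dotv w u + dotv w v.
Proof. by rewrite ![dotv w _]dotvC dotvDl. Qed.

Lemma dotvZl k u v : dotv (k *: u) v = k * dotv u v.
Proof. by rewrite !dotv3E !mxE; ring. Qed.

Lemma dotvZr k u v : dotv u (k *: v) = k * dotv u v.
Proof. by rewrite dotvC dotvZl dotvC. Qed.

Lemma dotv0 u : dotv u 0 = 0.
Proof. by rewrite -(scale0r u) dotvZr mul0r. Qed.

Lemma dotvv_ge0 u : 0 <= dotv u u.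
Proof. by apply: sumr_ge0 => i _; rewrite -expr2 sqr_ge0. Qed.

Lemma dotvv_eq0 u : (dotv u u == 0) = (u == 0).
Proof.
apply/idP/eqP => [|->]; last by rewrite dotv0.
rewrite psumr_eq0 => [/allP u0|i _]; last by rewrite -expr2 sqr_ge0.
apply/rowP => i; rewrite mxE; apply/eqP.
by have := u0 i (mem_index_enum _); rewrite -expr2 sqrf_eq0.
Qed.

Lemma enormZ k u : enorm (k *: u) = `|k| * enorm u.
Proof.
by rewrite /enorm dotvZl dotvZr mulrA -expr2 sqrtrM ?sqr_ge0 // sqrtr_sqr.
Qed.

Lemma sqr_enorm u : enorm u ^+ 2 = dotv u u.
Proof. by rewrite sqr_sqrtr // dotvv_ge0. Qed.

Lemma enorm_eq0 u : (enorm u == 0) = (u == 0).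
Proof. by rewrite -sqrf_eq0 sqr_enorm dotvv_eq0. Qed.

Lemma crossvDr u v w : crossv u (v + w) = crossv u v + crossv u w.
Proof. by apply/rowP => i; rewrite !mxE; ring. Qed.

Lemma crossvZl k u v : crossv (k *: u) v = k *: crossv u v.
Proof. by apply/rowP => i; rewrite !mxE; ring. Qed.

Lemma crossvZr k u v : crossv u (k *: v) = k *: crossv u v.
Proof. by apply/rowP => i; rewrite !mxE; ring. Qed.

Lemma crossvv u : crossv u u = 0.
Proof. by apply/rowP => i; rewrite !mxE; ring. Qed.

Lemma crossvC u v : crossv u v = - crossv v u.
Proof. by apply/rowP => i; rewrite !mxE; ring. Qed.

(** The triple product expansion, a polynomial identity in each coordinate. *)
Lemma crossv_crossv u v w :
  crossv u (crossv v w) = dotv u w *: v - dotv u v *: w.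
Proof.
have [x0 x1 x2] := crossv3E v w; have [y0 y1 y2] := crossv3E u (crossv v w).
by apply: rV3P; rewrite ?(y0, y1, y2) ?(x0, x1, x2) !mxE !dotv3E; ring.
Qed.

Lemma dotv_crossvl u v : dotv u (crossv u v) = 0.
Proof. by have [x0 x1 x2] := crossv3E u v; rewrite dotv3E x0 x1 x2; ring. Qed.

Lemma dotv_crossvr u v : dotv v (crossv u v) = 0.
Proof. by have [x0 x1 x2] := crossv3E u v; rewrite dotv3E x0 x1 x2; ring. Qed.

(** Lagrange's identity. *)
Lemma dotv_crossv2 u v :
  dotv (crossv u v) (crossv u v) = dotv u u * dotv v v - dotv u v ^+ 2.
Proof.
by have [x0 x1 x2] := crossv3E u v; rewrite !dotv3E x0 x1 x2; ring.
Qed.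

End VectorAlgebra.

(** * Differentiation of vector-valued functions *)

Section DerivativeRules.
Variables (R : realType).
Implicit Types (s k dk : R).

(** Reduces vector product rules to the scalar one, applied entry by entry. *)
Lemma is_derive_mxP m n (M : R -> 'M[R]_(m, n)) s (dM : 'M[R]_(m, n)) :
  is_derive s 1 M dM <->
  forall i j, is_derive s 1 (fun t => M t i j) (dM i j).
Proof.
split=> [[dvM <-] i j|dMij].
  rewrite derive_mx// mxE; apply: derivableP.
  by move/derivable_mxP : dvM; exact.
have dvM : derivable M s 1.
  by apply/derivable_mxP => i j; apply: (@ex_derive _ _ _ _ _ _ _ (dMij i j)).
apply: DeriveDef => //; apply/matrixP => i j.
by rewrite derive_mx// mxE; apply: (@derive_val _ _ _ _ _ _ _ (dMij i j)).
Qed.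

Lemma is_derive_scaler (k : R -> R) (v : R -> 'rV[R]_3) s dk dv :
  is_derive s 1 k dk -> is_derive s 1 v dv ->
  is_derive s 1 (fun t => k t *: v t) (dk *: v s + k s *: dv).
Proof.
move=> dk' /is_derive_mxP dv'; apply/is_derive_mxP => i j.
under eq_fun do rewrite mxE.
have dkv := is_deriveM dk' (dv' i j).
apply: (is_derive_eq dkv).
by rewrite !mxE addrC [_ *: dk]mulrC.
Qed.

Lemma is_derive_dotv (u v : R -> 'rV[R]_3) s du dv :
  is_derive s 1 u du -> is_derive s 1 v dv ->
  is_derive s 1 (fun t => dotv (u t) (v t)) (dotv du (v s) + dotv (u s) dv).
Proof.
move=> /is_derive_mxP du' /is_derive_mxP dv'.
rewrite (_ : (fun _ => _) = \sum_(i < 3) (fun t => u t 0 i * v t 0 i)).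
  have duv i := is_deriveM (du' 0 i) (dv' 0 i).
  apply: (is_derive_eq (is_derive_sum duv)).
  rewrite /dotv -big_split /=; apply: eq_bigr => i _.
  by rewrite addrC; congr (_ + _); rewrite mulrC.
by apply/funext => t; rewrite fct_sumE.
Qed.

(** Openness turns equality on [I] into equality near [s]. This lets formulas known only on [I] be
    differentiated. *)
Lemma is_derive_eq_on (V : normedModType R) (I : set R) (f g : R -> V) s df :
  open I -> I s -> (forall t, I t -> f t = g t) ->
  is_derive s 1 f df -> is_derive s 1 g df.
Proof.
move=> Iopen Is fg; apply: near_eq_is_derive.
by apply: filterS (open_nbhs_nbhs (conj Iopen Is)).
Qed.

Lemma derivable_eq_on (V : normedModType R) (I : set R) (f g : R -> V) s :
  open I -> I s -> (forall t, I t -> f t = g t) ->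
  derivable f s 1 -> derivable g s 1.
Proof.
move=> Iopen Is fg /derivableP df.
by have dg := is_derive_eq_on Iopen Is fg df; exact: ex_derive.
Qed.

Lemma derive1_is_derive (V : normedModType R) (f : R -> V) s df :
  is_derive s 1 f df -> derive1 f s = df.
Proof. by move=> dfs; rewrite derive1E derive_val. Qed.

Lemma derivable_is_derive1 (V : normedModType R) (f : R -> V) s :
  derivable f s 1 -> is_derive s 1 f (derive1 f s).
Proof. by move=> fs; rewrite derive1E; exact: derivableP. Qed.

End DerivativeRules.

(** * Vector products in an orthonormal pair *)

Section OrthonormalFrame.
Variables (R : realType) (T N : 'rV[R]_3).
Hypotheses (TT : dotv T T = 1) (NN : dotv N N = 1) (TN : dotv T N = 0).

Lemma dotv_crossv_orthonormal : dotv (crossv T N) (crossv T N) = 1.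
Proof. by rewrite dotv_crossv2 TT NN TN expr0n mulr1 subr0. Qed.

Lemma crossv_orthonormalr : crossv N (crossv T N) = T.
Proof. by rewrite crossv_crossv NN dotvC TN scale1r scale0r subr0. Qed.

End OrthonormalFrame.

(** * Orthogonality relations for the frame of a regular curve and for P^* *)

Section AssociatedVector.
Variables (R : realType) (I : set R) (g : R -> 'rV[R]_3) (s : R).
Hypothesis (g_regular : regular_on I g) (Is : I s).

Lemma dotv_binormal : dotv (binormal g s) (binormal g s) = 1.
Proof.
have [_ gg0] := g_regular Is.
by rewrite dotvZl dotvZr -sqr_enorm mulrA -expr2 exprVn mulVf// sqrf_eq0 enorm_eq0.
Qed.

Lemma dotv_normal_binormal : dotv (normal g s) (binormal g s) = 0.
Proof. by rewrite dotvC dotv_crossvl. Qed.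

Lemma dotv_binormal_derive1 : dotv (binormal g s) (derive1 g s) = 0.
Proof. by rewrite dotvZl dotvC dotv_crossvl mulr0. Qed.

(** N^* = B^* x T^* is orthogonal to T^*; regularity allows the factor 1/|g'| in T^* to be
    cancelled. *)
Lemma dotv_normal_derive1 : dotv (normal g s) (derive1 g s) = 0.
Proof.
have [g0 _] := g_regular Is.
have : dotv (normal g s) (tangent g s) = 0 by rewrite dotvC dotv_crossvr.
by rewrite dotvZr => /eqP; rewrite mulf_eq0 invr_eq0 enorm_eq0 (negPf g0) => /eqP.
Qed.

Lemma dotv_Pvec_derive1 c d : dotv (Pvec c d g s) (derive1 g s) = 0.
Proof.
by rewrite dotvZl dotvDl (dotvZl c) (dotvZl d) dotv_normal_derive1 dotv_binormal_derive1 !mulr0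
  addr0 mulr0.
Qed.

Lemma dotv_Pvec_binormal c d :
  dotv (Pvec c d g s) (binormal g s) = d / Num.sqrt (c ^+ 2 + d ^+ 2).
Proof.
by rewrite dotvZl dotvDl (dotvZl c) (dotvZl d) dotv_normal_binormal dotv_binormal mulr0 add0r
  mulr1 mulrC.
Qed.

End AssociatedVector.

(** * Consequences of the Frenet equations *)

Section FrenetFrame.
Variables (R : realType) (I : set R) (a T N B : R -> 'rV[R]_3).
Variables (kappa tau : R -> R).
Hypotheses (Iopen : open I) (frame : frenet_frame I a T N B kappa tau).

Lemma frenet_TB s : I s -> dotv (T s) (B s) = 0.
Proof. by move=> Is; rewrite (frenet_B frame Is) dotv_crossvl. Qed.

Lemma frenet_NB s : I s -> dotv (N s) (B s) = 0.
Proof. by move=> Is; rewrite (frenet_B frame Is) dotv_crossvr. Qed.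

Lemma frenet_BB s : I s -> dotv (B s) (B s) = 1.
Proof.
move=> Is; rewrite (frenet_B frame Is).
apply: dotv_crossv_orthonormal.
- exact: (frenet_TT frame Is).
- exact: (frenet_NN frame Is).
- exact: (frenet_TN frame Is).
Qed.

(** The Gram matrix of the frame as one rewrite rule: after bilinear expansion it evaluates every
    inner product of frame combinations. *)
Lemma frenet_dotE s : I s ->
  ((dotv (T s) (T s) = 1) * (dotv (N s) (N s) = 1) * (dotv (B s) (B s) = 1) *
   (dotv (T s) (N s) = 0) * (dotv (N s) (T s) = 0) *
   (dotv (T s) (B s) = 0) * (dotv (B s) (T s) = 0) *
   (dotv (N s) (B s) = 0) * (dotv (B s) (N s) = 0))%type.
Proof.
move=> Is; rewrite [dotv (N s) (T s)]dotvC [dotv (B s) (T s)]dotvC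
   [dotv (B s) (N s)]dotvC.
have TT := frenet_TT frame Is; have NN := frenet_NN frame Is.
have TN := frenet_TN frame Is; have TB := frenet_TB Is.
by have NB := frenet_NB Is; have BB := frenet_BB Is; do !split.
Qed.

Lemma enorm_darboux s x y : I s ->
  enorm (x *: B s + y *: T s) = Num.sqrt (x ^+ 2 + y ^+ 2).
Proof.
move=> Is; rewrite /enorm !(dotvDl, dotvDr, dotvZl, dotvZr) !frenet_dotE//.
by congr Num.sqrt; ring.
Qed.

(** * Curves whose velocity is mu N *)

Section NormalVelocity.
Variables (g : R -> 'rV[R]_3) (mu dmu : R -> R) (s : R).
Hypotheses (Is : I s).
Hypothesis dg : forall t, I t -> is_derive t 1 g (mu t *: N t).
Hypothesis dmuE : forall t, I t -> is_derive t 1 mu (dmu t).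

Lemma derive1_normal_velocity t : I t -> derive1 g t = mu t *: N t.
Proof. by move=> It; apply: derive1_is_derive; exact: dg. Qed.

Lemma derive2_normal_velocity t : I t ->
  derive1n 2 g t = dmu t *: N t + mu t *: (- kappa t *: T t + tau t *: B t).
Proof.
move=> It; apply: derive1_is_derive.
have dmuN := is_derive_scaler (dmuE It) (frenet_dN frame It).
apply: (is_derive_eq_on Iopen It _ dmuN) => u Iu.
by rewrite derive1_normal_velocity.
Qed.

(** The N part of g'' is parallel to g' and drops out; N x T = -B and N x B = T turn -kappa T + tau
    B into the Darboux vector. *)
Lemma crossv_normal_velocity :
  crossv (derive1 g s) (derive1n 2 g s)
  = mu s ^+ 2 *: (kappa s *: B s + tau s *: T s).
Proof.
rewrite derive1_normal_velocity// derive2_normal_velocity//.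
rewrite !(crossvZl, crossvZr, crossvDr) crossvv scaler0 add0r.
have NT : crossv (N s) (T s) = - B s by rewrite crossvC (frenet_B frame Is).
have NB : crossv (N s) (B s) = T s.
  rewrite (frenet_B frame Is).
  by rewrite crossv_orthonormalr ?(frenet_NN frame Is) ?(frenet_TN frame Is).
by rewrite NT NB scalerN scaleNr opprK scalerA -expr2.
Qed.

(** The Darboux vector is orthogonal to N and to N' = -kappa T + tau B, so of g''' only mu (-kappa'
    T + tau' B) contributes. *)
Lemma dotv_derive3_normal_velocity :
  derivable dmu s 1 -> derivable kappa s 1 -> derivable tau s 1 ->
  dotv (kappa s *: B s + tau s *: T s) (derive1n 3 g s)
  = mu s * (kappa s * derive1 tau s - derive1 kappa s * tau s).
Proof.
move=> /derivable_is_derive1 ddmu /derivable_is_derive1 dk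
  /derivable_is_derive1 dt.
have dN := frenet_dN frame Is; have dT := frenet_dT frame Is.
have dB := frenet_dB frame Is.
have d3 := is_deriveD (is_derive_scaler ddmu dN)
  (is_derive_scaler (dmuE Is)
     (is_deriveD (is_derive_scaler (is_deriveN dk) dT) (is_derive_scaler dt dB))).
have -> : derive1n 3 g s = _ := derive1_is_derive (is_derive_eq_on Iopen Is
  (fun t It => esym (derive2_normal_velocity It)) d3).
rewrite !(dotvDl, dotvDr, dotvZl, dotvZr) !frenet_dotE//.
(* The derivative rule for opposites left the function [- kappa] applied to [s]; [ring] needs the
   opposite of a value. *)
by rewrite -[(- kappa) s]/(- kappa s); ring.
Qed.

Lemma normal_velocity_neq0 : derive1 g s != 0 -> mu s != 0.
Proof.
by apply: contraNneq => mu0; rewrite derive1_normal_velocity// mu0 scale0r.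
Qed.

Lemma darboux_norm_gt0 : 0 < Num.sqrt (kappa s ^+ 2 + tau s ^+ 2).
Proof.
by rewrite sqrtr_gt0 ltr_wpDr ?sqr_ge0// exprn_gt0// (frenet_kappa_gt0 frame Is).
Qed.

(** The vector product contributes mu^2 and the speed |mu|^3. The remaining absolute value is the
    source of the sign cases in the theorem. *)
Lemma curvature_normal_velocity : mu s != 0 ->
  curvature g s = Num.sqrt (kappa s ^+ 2 + tau s ^+ 2) / `|mu s|.
Proof.
move=> mu0; rewrite /curvature crossv_normal_velocity derive1_normal_velocity//.
rewrite !enormZ enorm_darboux// /enorm (frenet_NN frame Is) sqrtr1 normrX.
have : `|mu s| != 0 by rewrite normr_eq0.
by move=> ?; field.
Qed.

(** The powers of mu are mu^2 mu over mu^4, so the sign of mu is kept and no absolute value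
    appears. *)
Lemma torsion_normal_velocity : mu s != 0 ->
  derivable dmu s 1 -> derivable kappa s 1 -> derivable tau s 1 ->
  torsion g s = (kappa s * derive1 tau s - derive1 kappa s * tau s)
    / (mu s * (kappa s ^+ 2 + tau s ^+ 2)).
Proof.
move=> mu0 ddmu dk dt; rewrite /torsion crossv_normal_velocity dotvZl.
rewrite dotv_derive3_normal_velocity// enormZ exprMn enorm_darboux//.
rewrite sqr_sqrtr ?addr_ge0 ?sqr_ge0// real_normK ?num_real//.
have : kappa s ^+ 2 + tau s ^+ 2 != 0.
  by rewrite gt_eqF// -sqrtr_gt0; exact: darboux_norm_gt0.
by move=> ?; field; apply/andP.
Qed.

(** The factor mu^2 is positive, so normalizing removes it whatever the sign of mu. *)
Lemma binormal_normal_velocity : mu s != 0 ->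
  binormal g s = (Num.sqrt (kappa s ^+ 2 + tau s ^+ 2))^-1
    *: (kappa s *: B s + tau s *: T s).
Proof.
move=> mu0; rewrite /binormal crossv_normal_velocity enormZ enorm_darboux//.
rewrite ger0_norm ?sqr_ge0// scalerA; congr (_ *: _).
have := lt0r_neq0 darboux_norm_gt0.
by move=> ?; field; apply/andP.
Qed.

End NormalVelocity.

(** * Differentiability of curvature and torsion *)

Section Differentiability.
Hypothesis a_smooth : smooth_on I a.

Lemma frenet_derive1 s : I s -> derive1 a s = T s.
Proof. by move=> Is; apply: derive1_is_derive; exact: frenet_curve frame _ Is. Qed.

Lemma frenet_derive2 s : I s -> derive1n 2 a s = kappa s *: N s.
Proof.
move=> Is; apply: derive1_is_derive.
apply: (is_derive_eq_on Iopen Is _ (frenet_dT frame Is)) => t It.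
by rewrite frenet_derive1.
Qed.

Lemma frenet_kappaE s : I s -> kappa s = dotv (derive1n 2 a s) (N s).
Proof.
by move=> Is; rewrite frenet_derive2// dotvZl (frenet_NN frame Is) mulr1.
Qed.

(** In the derivative of <alpha'', N> the term <alpha'', N'> vanishes, since alpha'' is along N and
    N' is orthogonal to N. *)
Lemma frenet_is_derive_kappa s : I s ->
  is_derive s 1 kappa (dotv (derive1n 3 a s) (N s)).
Proof.
move=> Is.
(* Smoothness at index 2 says that the second derivative is derivable, which provides alpha'''. *)
have dk := is_derive_dotv (derivable_is_derive1 (@a_smooth 2%N _ Is))
  (frenet_dN frame Is).
apply: (is_derive_eq_on Iopen Is (fun t It => esym (frenet_kappaE It)) _).
apply: (is_derive_eq dk).
rewrite frenet_derive2// !(dotvDl, dotvDr, dotvZl, dotvZr) !frenet_dotE//.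
by rewrite !(mulr0, addr0).
Qed.

Lemma frenet_derivable_kappa s : I s -> derivable kappa s 1.
Proof. by move=> /frenet_is_derive_kappa dk; exact: ex_derive. Qed.

(** The closed form <alpha''', N> of kappa' can be differentiated again. The third derivative of the
    associated curve involves kappa''. *)
Lemma frenet_derivable_dkappa s : I s -> derivable (derive1 kappa) s 1.
Proof.
move=> Is.
have dk := is_derive_dotv (derivable_is_derive1 (@a_smooth 3%N _ Is))
  (frenet_dN frame Is).
apply: (derivable_eq_on Iopen Is _ (@ex_derive _ _ _ _ _ _ _ dk)) => t It.
by apply/esym/derive1_is_derive; exact: frenet_is_derive_kappa.
Qed.

Lemma frenet_derive3 s : I s ->
  derive1n 3 a s
  = derive1 kappa s *: N s + kappa s *: (- kappa s *: T s + tau s *: B s).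
Proof.
move=> Is; apply: derive1_is_derive.
have dk := derivable_is_derive1 (frenet_derivable_kappa Is).
apply: (is_derive_eq_on Iopen Is _ (is_derive_scaler dk (frenet_dN frame Is))).
by move=> t It; rewrite -frenet_derive2.
Qed.

Lemma frenet_tauE s : I s -> tau s = (kappa s)^-1 * dotv (derive1n 3 a s) (B s).
Proof.
move=> Is; rewrite frenet_derive3// !(dotvDl, dotvDr, dotvZl, dotvZr).
rewrite !frenet_dotE// !mulr0 !add0r mulr1 mulrA mulVf ?mul1r//.
by rewrite gt_eqF// (frenet_kappa_gt0 frame Is).
Qed.

Lemma frenet_derivable_tau s : I s -> derivable tau s 1.
Proof.
move=> Is.
have k0 : kappa s != 0 by rewrite gt_eqF// (frenet_kappa_gt0 frame Is).
have dkV := derivableP (derivableV k0 (frenet_derivable_kappa Is)).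
have dt := is_deriveM dkV (is_derive_dotv (derivable_is_derive1 (@a_smooth 3%N _ Is))
  (frenet_dB frame Is)).
by apply: (derivable_eq_on Iopen Is _ (@ex_derive _ _ _ _ _ _ _ dt)) => t It; rewrite frenet_tauE.
Qed.

End Differentiability.
End FrenetFrame.

(** * The associated curve *)

(* The velocity (1 + lambda') T + lambda kappa N of [astar] is orthogonal to
   P^* = T, so that 1 + lambda' = 0. *)
Lemma TP_associated_derive (R : realType) (I : set R)
    (a T N B astar : R -> 'rV[R]_3) (kappa tau lambda : R -> R) (c d : R) :
    open I -> frenet_frame I a T N B kappa tau ->
    TP_associated I c d a T lambda astar ->
  forall s, I s -> derive1 lambda s = - 1 /\
    is_derive s 1 astar ((lambda s * kappa s) *: N s).
Proof.
move=> Iopen frame TP s Is.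
have dl := derivable_is_derive1 (@TP_lambda_smooth _ _ _ _ _ _ _ _ TP 0%N _ Is).
have dastar := is_derive_eq_on Iopen Is
  (fun t It => esym (TP_curve TP It))
  (is_deriveD (frenet_curve frame Is) (is_derive_scaler dl (frenet_dT frame Is))).
have := dotv_Pvec_derive1 (TP_regular TP) Is c d.
rewrite -(TP_direction TP Is) (derive1_is_derive dastar).
rewrite !(dotvDr, dotvZr) (frenet_TT frame Is) (frenet_TN frame Is).
rewrite !mulr0 addr0 mulr1 => /eqP; rewrite addrC addr_eq0 => /eqP l1.
split=> //; apply: (is_derive_eq dastar).
by rewrite [derive1 _ _]l1 addrA scaleN1r subrr add0r scalerA.
Qed.

Theorem theorem2p5 (R : realType) (I : set R)
  (hIopen : open I) (hIitv : is_interval I)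
  (alpha T N B : R -> 'rV[R]_3) (kappa tau : R -> R)
  (halpha : smooth_on I alpha)
  (hframe : frenet_frame I alpha T N B kappa tau)
  (c d : R) (hcd : (c != 0) || (d != 0))
  (lambda : R -> R) (alphastar : R -> 'rV[R]_3)
  (hTP : TP_associated I c d alpha T lambda alphastar) :
  forall s : R, I s ->
    [/\ 0 < lambda s ->
          (d != 0 ->
             curvature alphastar s
             = tau s * Num.sqrt (c ^+ 2 + d ^+ 2) / (d * lambda s * kappa s))
          /\ curvature alphastar s
             = Num.sqrt (kappa s ^+ 2 + tau s ^+ 2) / (lambda s * kappa s),
        lambda s < 0 ->
          (d != 0 ->
             curvature alphastar s
             = - (tau s * Num.sqrt (c ^+ 2 + d ^+ 2)
                  / (d * lambda s * kappa s)))
          /\ curvature alphastar s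
             = - (Num.sqrt (kappa s ^+ 2 + tau s ^+ 2) / (lambda s * kappa s)),
        lambda s != 0
      & torsion alphastar s
        = (kappa s * derive1 tau s - derive1 kappa s * tau s)
          / (lambda s * kappa s * (kappa s ^+ 2 + tau s ^+ 2))].
Proof.
move=> s Is.
have dastar t (It : I t) := (TP_associated_derive hIopen hframe hTP It).2.
have dlambda t (It : I t) := (TP_associated_derive hIopen hframe hTP It).1.
have dk := frenet_derivable_kappa hIopen hframe halpha.
have dt := frenet_derivable_tau hIopen hframe halpha.
have dl t (It : I t) := derivable_is_derive1 (@TP_lambda_smooth _ _ _ _ _ _ _ _ hTP 0%N _ It).
pose mu t := lambda t * kappa t.
(* The product rule for lambda kappa, with lambda' = -1 substituted. *)
pose dmu t := - kappa t + lambda t * derive1 kappa t.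
have dmuE t : I t -> is_derive t 1 mu (dmu t).
  move=> It; have dlk := is_deriveM (dl t It) (derivable_is_derive1 (dk t It)).
  apply: (is_derive_eq dlk).
  by rewrite [derive1 lambda t]dlambda// /dmu addrC [_ *: -1]mulrN1.
have ddmu : derivable dmu s 1.
  apply: derivableD; first by apply: derivableN; exact: dk.
  apply: derivableM; first exact: (@TP_lambda_smooth _ _ _ _ _ _ _ _ hTP 0%N).
  exact: (frenet_derivable_dkappa hIopen hframe halpha Is).
have [astar0 _] := TP_regular hTP Is.
have mu0 : mu s != 0 := normal_velocity_neq0 Is dastar astar0.
have k0 := frenet_kappa_gt0 hframe Is.
have l0 : lambda s != 0 by move: mu0; rewrite mulf_eq0 => /norP[].
have := curvature_normal_velocity hIopen hframe Is dastar dmuE mu0.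
have w0 := darboux_norm_gt0 hframe Is.
set w := Num.sqrt (kappa s ^+ 2 + _) in w0 *.
set r := Num.sqrt (c ^+ 2 + d ^+ 2) => curvE.
have r0 : r != 0.
  rewrite sqrtr_eq0 -ltNge lt_neqAle addr_ge0 ?sqr_ge0// andbT eq_sym.
  by rewrite paddr_eq0 ?sqr_ge0// !sqrf_eq0 negb_and.
(* Both tau / w and d / r equal <T, B^*>; this is the relation without denominators. *)
have tauE : tau s * r = d * w.
  have := dotv_Pvec_binormal (TP_regular hTP) Is c d.
  rewrite -(TP_direction hTP Is).
  rewrite (binormal_normal_velocity hIopen hframe Is dastar dmuE mu0).
  rewrite !(dotvDr, dotvZr) !(frenet_dotE hframe Is) mulr0 add0r mulr1 -/w -/r.
  by move=> e; rewrite -[tau s](mulVKf (lt0r_neq0 w0)) e; field.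
(* Substituting tau r = d w cancels d and identifies the two curvature expressions. *)
have tauwE : d != 0 -> tau s * r / (d * lambda s * kappa s) = w / mu s.
  by move=> d0; rewrite tauE /mu; field; rewrite d0 l0 gt_eqF.
have torsE := torsion_normal_velocity hIopen hframe Is dastar dmuE mu0 ddmu
  (dk s Is) (dt s Is).
(* As kappa > 0, mu has the sign of lambda, which resolves |mu| in each case. *)
split=> // [lpos|lneg].
- have -> : curvature alphastar s = w / mu s.
    by rewrite curvE gtr0_norm// mulr_gt0.
  by split=> // d0; rewrite tauwE.
- have -> : curvature alphastar s = - (w / mu s).
    by rewrite curvE ltr0_norm ?nmulr_rlt0// invrN mulrN.
  by split=> // d0; rewrite tauwE.
Qed.
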